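(* Let $d,l,m\geq1$, fix arbitrary norms $\|\cdot\|$ on $H(d)$ and on $M_{lm}(\mathbb{R})$, and let $\mathcal{Q}=\{P_1,\dots,P_l\}$ be a measurement scheme of POVMs with outcome set $\{1,\dots,m\}$ which determines any pure state among all states. Then there is a constant $C_{\mathcal{Q}}>0$ such that for every $\epsilon>0$, every pure state $\sigma$ and every $f\in M_{lm}(\mathbb{R})$ with $\|f\|\leq\epsilon$, setting $b=M_{\mathcal{Q}}(\sigma)+f$, any minimizer $Y^*$ of the semidefinite program $$\text{minimize } \mathrm{tr}(Y)\quad\text{subject to } Y\in H(d),\ Y\geq0,\ \|M_{\mathcal{Q}}(Y)-b\|\leq\epsilon$$ satisfies $\|Y^*-\sigma\|\leq C_{\mathcal{Q}}\,\epsilon$.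
   Context: $H(d)$ is the real vector space of $d\times d$ complex Hermitian matrices and $M_{lm}(\mathbb{R})$ the real $l\times m$ matrices. A POVM with outcome set $\{1,\dots,m\}$ is a map $j\mapsto P(j)\in H(d)$ with $P(j)\geq0$ and $\sum_j P(j)=\mathbb{1}$. The scheme induces $M_{\mathcal{Q}}:H(d)\to M_{lm}(\mathbb{R})$, $M_{\mathcal{Q}}(X)_{i,j}=\mathrm{tr}(XP_i(j))$. A state is a positive semidefinite trace-one matrix; a pure state is a rank-one state $|\psi\rangle\langle\psi|$. $\mathcal{Q}$ determines any pure state among all states if for every pure state $\sigma$ and every state $\varrho$, $M_{\mathcal{Q}}(\sigma)=M_{\mathcal{Q}}(\varrho)$ implies $\varrho=\sigma$. *)

(* Defs.v *)
From HB Require Import structures.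
From mathcomp Require Import all_boot all_order all_algebra.
From mathcomp Require Import complex.
From mathcomp Require Import reals.
Set Implicit Arguments. Unset Strict Implicit. Unset Printing Implicit Defensive.
Import Order.TTheory GRing.Theory Num.Theory.
Local Open Scope ring_scope.

Section Defs.
Variable R : realType.
Local Notation C := (complex R).

Definition adjmx (m n : nat) (A : 'M[C]_(m, n)) : 'M[C]_(n, m) :=
  map_mx (@conjc R) A^T.

Definition hermitian (d : nat) (X : 'M[C]_d) : Prop := adjmx X = X.

Definition psd (d : nat) (X : 'M[C]_d) : Prop :=
  hermitian X /\ forall v : 'cV[C]_d, 0 <= (adjmx v *m X *m v) 0 0.

Definition state (d : nat) (X : 'M[C]_d) : Prop := psd X /\ \tr X = 1.

Definition pure_state (d : nat) (X : 'M[C]_d) : Prop :=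
  state X /\ \rank X = 1%N.

Definition povm (d m : nat) (P : 'I_m -> 'M[C]_d) : Prop :=
  (forall j, psd (P j)) /\ \sum_(j < m) P j = 1%:M.

Definition meas_map (d l m : nat) (P : 'I_l -> 'I_m -> 'M[C]_d)
  (X : 'M[C]_d) : 'M[R]_(l, m) :=
  \matrix_(i < l, j < m) complex.Re (\tr (X *m P i j)).

Definition determines_pure (d l m : nat) (P : 'I_l -> 'I_m -> 'M[C]_d) : Prop :=
  forall sigma rho : 'M[C]_d, pure_state sigma -> state rho ->
    meas_map P sigma = meas_map P rho -> rho = sigma.

Definition norm_on_herm (d : nat) (N : 'M[C]_d -> R) : Prop :=
  [/\ forall X, hermitian X -> 0 <= N X,
      forall X, hermitian X -> N X = 0 -> X = 0,
      forall (a : R) X, hermitian X -> N ((a%:C)%C *: X) = `|a| * N X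
    & forall X Y, hermitian X -> hermitian Y -> N (X + Y) <= N X + N Y].

Definition norm_on_mx (l m : nat) (N : 'M[R]_(l, m) -> R) : Prop :=
  [/\ forall f, 0 <= N f,
      forall f, N f = 0 -> f = 0,
      forall (a : R) f, N (a *: f) = `|a| * N f
    & forall f g, N (f + g) <= N f + N g].

Definition sdp_feasible (d l m : nat) (P : 'I_l -> 'I_m -> 'M[C]_d)
  (Nf : 'M[R]_(l, m) -> R) (eps : R) (b : 'M[R]_(l, m)) (Y : 'M[C]_d) : Prop :=
  psd Y /\ Nf (meas_map P Y - b) <= eps.

Definition sdp_minimizer (d l m : nat) (P : 'I_l -> 'I_m -> 'M[C]_d)
  (Nf : 'M[R]_(l, m) -> R) (eps : R) (b : 'M[R]_(l, m)) (Y : 'M[C]_d) : Prop :=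
  sdp_feasible P Nf eps b Y /\
  forall Z, sdp_feasible P Nf eps b Z -> complex.Re (\tr Y) <= complex.Re (\tr Z).

End Defs.

(* Main.v *)
Require Import Defs.
From HB Require Import structures.
From mathcomp Require Import all_boot all_order all_algebra.
From mathcomp Require Import complex.
From mathcomp Require Import reals.
From mathcomp Require Import boolp classical_sets topology normedtype derive.
Set Implicit Arguments. Unset Strict Implicit. Unset Printing Implicit Defensive.
Import Order.TTheory GRing.Theory Num.Theory.
Import numFieldNormedType.Exports.
Local Open Scope classical_set_scope.
Local Open Scope ring_scope.

(** Feasibility of [Y] alone gives [Nf (M (Y - sigma)) <= 2 eps], so it suffices
    to bound [Nf (M Z)] from below by a multiple of the size of [Z] for the
    differences [Z = Y - sigma].  Write [sigma = u adj(u)] and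
    [Q = 1 - u adj(u)]; then [Z] has a nonnegative quadratic form on the
    hyperplane orthogonal to the unit vector [u].  This property is invariant
    under scaling of [Z] and, being equivalent to [Q Z Q >= 0], it is closed in
    the pair [(Z, u)], so [Nf (M Z)] attains its minimum over the normalised
    pairs.  The minimum is positive: if [M Z = 0] with [Z <> 0], then [tr Z = 0],
    so [Z] has exactly one negative eigenvalue [-t], with eigenprojection
    [sigma'], and the state [(Z + t sigma') / t] would have the same measurement
    data as the pure state [sigma']. *)

(** * Hermitian matrices with one negative eigenvalue *)

Lemma adjmxE (R : realType) m n (A : 'M[complex R]_(m, n)) :
  adjmx A = map_mx Num.conj A^T.
Proof. by apply/matrixP=> i j; rewrite !mxE. Qed.

Lemma adjmxK (R : realType) m n (A : 'M[complex R]_(m, n)) :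
  adjmx (adjmx A) = A.
Proof. by rewrite !adjmxE trmxCK. Qed.

Lemma adjmxM (R : realType) m n p (A : 'M[complex R]_(m, n))
  (B : 'M[complex R]_(n, p)) : adjmx (A *m B) = adjmx B *m adjmx A.
Proof. by rewrite !adjmxE trmx_mul map_mxM. Qed.

Lemma adjmxD (R : realType) m n (A B : 'M[complex R]_(m, n)) :
  adjmx (A + B) = adjmx A + adjmx B.
Proof. by rewrite !adjmxE linearD map_mxD. Qed.

Lemma adjmxB (R : realType) m n (A B : 'M[complex R]_(m, n)) :
  adjmx (A - B) = adjmx A - adjmx B.
Proof. by rewrite !adjmxE linearB map_mxB. Qed.

Lemma adjmxZ (R : realType) m n (a : complex R) (A : 'M[complex R]_(m, n)) :
  adjmx (a *: A) = a^* *: adjmx A.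
Proof. by rewrite !adjmxE linearZ map_mxZ. Qed.

Lemma hermitianZ (R : realType) d (a : R) (X : 'M[complex R]_d) :
  Defs.hermitian X -> Defs.hermitian ((a%:C)%C *: X).
Proof.
move=> hX; rewrite /Defs.hermitian adjmxZ hX; congr (_ *: _).
by apply/CrealP; rewrite complex_real.
Qed.

Lemma adjmx1 (R : realType) n : adjmx (1%:M : 'M[complex R]_n) = 1%:M.
Proof. by rewrite adjmxE trmx1 map_mx1. Qed.

Lemma adj_mulmx_ge0 (R : realType) n (A : 'cV[complex R]_n) :
  0 <= (adjmx A *m A) 0 0.
Proof.
rewrite mxE sumr_ge0 // => i _; rewrite adjmxE !mxE mulrC.
exact: mul_conjC_ge0.
Qed.

Lemma pure_state_outer (R : realType) d (u : 'cV[complex R]_d) :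
  adjmx u *m u = 1%:M -> pure_state (u *m adjmx u).
Proof.
move=> u1; have tru : \tr (u *m adjmx u) = 1.
  by rewrite mxtrace_mulC u1 mxtrace1.
split; first split=> //.
  split; first by rewrite /Defs.hermitian adjmxM adjmxK.
  move=> v; rewrite mulmxA -mulmxA -{1}[u]adjmxK -adjmxM.
  exact: adj_mulmx_ge0.
apply/eqP; rewrite eqn_leq; apply/andP; split.
  by apply: leq_trans (mxrankM_maxr _ _) (rank_leq_row _).
rewrite lt0n mxrank_eq0; apply: contra_eq_neq tru => ->.
by rewrite mxtrace0 eq_sym oner_neq0.
Qed.

Lemma quad_diag (R : realType) d (s : 'rV[complex R]_d) (w : 'cV[complex R]_d) :
  (adjmx w *m diag_mx s *m w) 0 0 = \sum_j s 0 j * `|w j 0| ^+ 2.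
Proof.
rewrite mul_mx_diag mxE; apply: eq_bigr => j _.
by rewrite adjmxE !mxE normCK mulrAC [RHS]mulrC [X in X * _]mulrC.
Qed.

Lemma quad_conj (R : realType) d (U D : 'M[complex R]_d) (w : 'cV[complex R]_d) :
  adjmx w *m (adjmx U *m D *m U) *m w = adjmx (U *m w) *m D *m (U *m w).
Proof. by rewrite adjmxM !mulmxA. Qed.

Lemma creal_Re (R : realType) (x : complex R) :
  x \is Num.real -> ((complex.Re x)%:C)%C = x.
Proof. by case: x => a b; rewrite complex_real => /eqP ->. Qed.

(** The spectral theorem, in the convention where the eigenvectors are the columns of [adjmx U]. *)
Lemma hermitian_diagonalization (R : realType) d (X : 'M[complex R]_d) :
  Defs.hermitian X ->
  exists (U : 'M[complex R]_d) (s : 'rV[complex R]_d),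
    [/\ U *m adjmx U = 1%:M, X = adjmx U *m diag_mx s *m U
      & forall j, s 0 j \is Num.real].
Proof.
move=> hX; have hX' : X \is hermsymmx.
  by apply/is_hermitianmxP; rewrite expr0 scale1r -adjmxE.
have UX := spectral_unitarymx X.
exists (spectralmx X), (spectral_diag X); split.
- by rewrite adjmxE; apply/unitarymxP.
- rewrite adjmxE -invmx_unitary //.
  exact/orthomx_spectralP/hermitian_normalmx.
- by move=> j; have /mxOverP := hermitian_spectral_diag_real hX'; apply.
Qed.

(* At most one eigenvalue of [X] is negative, since the hyperplane [b w = 0]
   meets the span of any two eigenvectors. *)
Lemma hermitian_one_negative (R : realType) d (X : 'M[complex R]_d)
    (b : 'rV[complex R]_d) :
  Defs.hermitian X -> \tr X = 0 ->
  (forall w : 'cV[complex R]_d, b *m w = 0 -> 0 <= (adjmx w *m X *m w) 0 0) ->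
  X = 0 \/ exists (t : R) (sigma : 'M[complex R]_d),
    [/\ 0 < t, pure_state sigma & psd (X + (t%:C)%C *: sigma)].
Proof.
move=> hX trX Xb.
have [U [s [UU Xs s_real]]] := hermitian_diagonalization hX.
have sq_ge0 (x : complex R) : 0 <= `|x| ^+ 2 by rewrite exprn_ge0.
(* If no eigenvalue is negative, zero trace forces all of them to vanish. *)
have [/forallP s_ge0|] := boolP [forall j, 0 <= s 0 j].
  left; rewrite Xs; suff -> : s = 0 by rewrite linear0 mulmx0 mul0mx.
  apply/rowP => j; rewrite mxE.
  move: trX; rewrite Xs mxtrace_mulC mulmxA UU mul1mx mxtrace_diag.
  move=> /eqP; rewrite psumr_eq0 // => /allP/(_ j).
  by rewrite mem_index_enum => /(_ isT)/eqP.
rewrite negb_forall => /existsP[i si_lt0]; right.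
(* The order on [complex R] is partial; the negation becomes a strict inequality because the
   eigenvalues are real. *)
have {}si_lt0 : s 0 i < 0 by rewrite real_ltNge ?real0.
pose e j : 'cV[complex R]_d := delta_mx j 0.
have s_ge0 j : j != i -> 0 <= s 0 j.
  move=> ji; rewrite real_leNgt ?real0 //; apply/negP => sj_lt0.
  (* [c k] is the value of [b] on the [k]-th eigenvector. With two negative eigenvalues, a nonzero
     combination of their eigenvectors killed by [b] would have a strictly negative quadratic
     form. *)
  pose c k := (b *m adjmx U *m e k) 0 0.
  have form_lt0 x y : x * c i + y * c j = 0 -> (x != 0) || (y != 0) -> False.
    move=> xy0 xy.
    have := Xb (adjmx U *m (x *: e i + y *: e j)).
    rewrite {1}Xs quad_conj (mulmxA U (adjmx U)) UU mul1mx quad_diag.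
    rewrite mulmxA; have -> : b *m adjmx U *m (x *: e i + y *: e j) = 0.
      rewrite mulmxDr -!scalemxAr; apply/matrixP => p q; rewrite !ord1.
      by rewrite !mxE -/(c i) -[RHS]xy0; congr (_ * _ + _ * _); rewrite /c mxE.
    move=> /(_ erefl).
    rewrite (bigD1 i) //= (bigD1 j) //= big1 ?addr0; last first.
      move=> k /andP[ki kj]; rewrite !mxE (negbTE ki) (negbTE kj).
      by rewrite !mulr0 addr0 normr0 expr0n mulr0.
    rewrite !mxE !eqxx (negbTE ji) eq_sym (negbTE ji) /=.
    rewrite !mulr0 !mulr1 addr0 add0r.
    apply/negP; rewrite -real_ltNge ?real0 //; last first.
      by rewrite realD // realM // ger0_real.
    have hx : s 0 i * `|x| ^+ 2 <= 0 by rewrite mulr_le0_ge0 // ltW.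
    have hy : s 0 j * `|y| ^+ 2 <= 0 by rewrite mulr_le0_ge0 // ltW.
    rewrite lt_def; apply/andP; split; last first.
      by rewrite (le_trans (lerD hx hy)) ?addr0.
    (* Two nonpositive terms add up to zero only if both vanish, that is, only if [x] and [y] do. *)
    rewrite eq_sym naddr_eq0 // !mulf_eq0 (lt_eqF si_lt0) (lt_eqF sj_lt0).
    rewrite !orFb !orbb !normr_eq0.
    by rewrite negb_and.
  (* A nonzero solution of [x * c i + y * c j = 0]: take [(1, 0)] if [c i = 0], and [(c j, - c i)]
     otherwise. *)
  have [ci0|ci0] := eqVneq (c i) 0.
    by apply: (@form_lt0 1 0); rewrite ?ci0 ?mulr0 ?mul0r ?addr0 ?oner_neq0.
  apply: (@form_lt0 (c j) (- c i)); first by rewrite mulNr mulrC subrr.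
  by rewrite oppr_eq0 ci0 orbT.
pose u := adjmx U *m e i.
have uu : adjmx u *m u = 1%:M.
  rewrite adjmxM adjmxK mulmxA -(mulmxA (adjmx (e i))) UU mulmx1.
  apply/matrixP=> p q; rewrite !ord1 mxE (bigD1 i) //= big1 ?addr0.
    by rewrite adjmxE !mxE !eqxx /= rmorph1 mulr1.
  by move=> k ki; rewrite adjmxE !mxE (negbTE ki) mulr0.
(* Adding this multiple of the eigenprojection replaces the negative eigenvalue by 0 and keeps the
   other, nonnegative ones. *)
exists (- complex.Re (s 0 i)), (u *m adjmx u).
have siE : ((- complex.Re (s 0 i))%:C)%C = - s 0 i.
  by rewrite rmorphN /= creal_Re.
split.
- by rewrite -ltcR siE oppr_gt0.
- exact: pure_state_outer.
have -> : X + ((- complex.Re (s 0 i))%:C)%C *: (u *m adjmx u) =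
    adjmx U *m diag_mx (\row_j if j == i then 0 else s 0 j) *m U.
  rewrite {1}Xs siE /u adjmxM adjmxK !mulmxA -(mulmxA _ (e i)).
  rewrite scalemxAl scalemxAr -mulmxDl -mulmxDr; congr (_ *m _ *m _).
  apply/matrixP => p q; rewrite !mxE big_ord1 adjmxE !mxE !eqxx !andbT conjC_nat.
  have [->|pi] := eqVneq p i; last by rewrite mul0r mulr0 addr0.
  rewrite mul1r [q == i]eq_sym; case: eqP => _ /=; last by rewrite mulr0 addr0.
  by rewrite mulr1 mulr1n subrr.
split; last first.
  move=> w; rewrite quad_conj quad_diag sumr_ge0 // => j _.
  by rewrite mxE; case: ifPn => [_|/s_ge0 ?]; rewrite ?mul0r // mulr_ge0.
rewrite /Defs.hermitian !adjmxM adjmxK mulmxA; congr (_ *m _ *m _).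
apply/matrixP => p q; rewrite adjmxE !mxE [p == q]eq_sym.
case: (eqVneq q p) => [->|_]; last by rewrite rmorph0.
rewrite mulr1n; case: eqP => _; first by rewrite rmorph0.
by have /CrealP := s_real p.
Qed.

(** * The measurement map and its kernel *)

Lemma meas_mapE (R : realType) d l m (P : 'I_l -> 'I_m -> 'M[complex R]_d) X i j :
  meas_map P X i j = complex.Re (\tr (X *m P i j)).
Proof. by rewrite mxE. Qed.

Lemma meas_mapD (R : realType) d l m (P : 'I_l -> 'I_m -> 'M[complex R]_d) X Y :
  meas_map P (X + Y) = meas_map P X + meas_map P Y.
Proof.
apply/matrixP=> i j; rewrite !mxE mulmxDl mxtraceD.
by case: (\tr _) (\tr _) => [a b] [c e].
Qed.

Lemma meas_mapZ (R : realType) d l m (P : 'I_l -> 'I_m -> 'M[complex R]_d)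
    (a : R) X :
  meas_map P ((a%:C)%C *: X) = a *: meas_map P X.
Proof.
apply/matrixP=> i j; rewrite !mxE -scalemxAl mxtraceZ.
by case: (\tr _) => [b c] /=; rewrite mul0r subr0.
Qed.

Lemma meas_mapB (R : realType) d l m (P : 'I_l -> 'I_m -> 'M[complex R]_d) X Y :
  meas_map P (X - Y) = meas_map P X - meas_map P Y.
Proof.
have -> : X - Y = X + ((-1)%:C)%C *: Y by rewrite rmorphN1 scaleN1r.
by rewrite meas_mapD meas_mapZ scaleN1r.
Qed.

Lemma hermitian_tr_real (R : realType) d (X : 'M[complex R]_d) :
  Defs.hermitian X -> complex.Im (\tr X) = 0.
Proof.
move=> hX; have : \tr X \is Num.real.
  by apply/CrealP; rewrite -[in RHS]hX adjmxE trace_map_mx mxtrace_tr.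
by move=> /creal_Re <-.
Qed.

(** The effects sum to the identity, so the data of a single POVM already determine the trace. *)
Lemma povm_tr (R : realType) d m (P : 'I_m -> 'M[complex R]_d) X :
  povm P -> \tr X = \sum_j \tr (X *m P j).
Proof. by move=> [_ P1]; rewrite -raddf_sum -mulmx_sumr P1 mulmx1. Qed.

Lemma psdZ (R : realType) d (a : R) (X : 'M[complex R]_d) :
  0 <= a -> psd X -> psd ((a%:C)%C *: X).
Proof.
move=> a_ge0 [hX X_ge0]; split; first exact: hermitianZ.
by move=> v; rewrite -scalemxAr -scalemxAl mxE mulr_ge0 // ler0c.
Qed.

Lemma meas_map_inj_one_negative (R : realType) d l m
    (P : 'I_l -> 'I_m -> 'M[complex R]_d) (i0 : 'I_l) (X : 'M[complex R]_d)
    (b : 'rV[complex R]_d) :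
  povm (P i0) -> determines_pure P -> Defs.hermitian X ->
  (forall w : 'cV[complex R]_d, b *m w = 0 -> 0 <= (adjmx w *m X *m w) 0 0) ->
  meas_map P X = 0 -> X = 0.
Proof.
move=> hP hdet hX Xb MX0.
have trX : \tr X = 0.
  (* The data record real parts only; the imaginary part of the trace vanishes because [X] is
     Hermitian. *)
  apply/eqP; rewrite eq_complex hermitian_tr_real // eqxx andbT.
  rewrite (povm_tr X hP) raddf_sum /= big1 // => j _.
  by rewrite -meas_mapE MX0 mxE.
have [//|[t [sigma [t_gt0 ps pX]]]] := hermitian_one_negative hX trX Xb.
(* As [X] has trace 0 and zero data, [rho] has trace 1 and the data of [sigma]. *)
pose rho := ((t^-1)%:C)%C *: (X + (t%:C)%C *: sigma).
have tV : ((t^-1)%:C * t%:C)%C = 1 :> complex R.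
  by rewrite -rmorphM /= mulVf ?gt_eqF.
have [[_ trs] _] := ps.
have : rho = sigma.
  apply: hdet => //.
    split; first by apply: psdZ => //; rewrite invr_ge0 ltW.
    by rewrite mxtraceZ mxtraceD mxtraceZ trX trs add0r mulr1.
  rewrite meas_mapZ meas_mapD meas_mapZ MX0 add0r scalerA.
  by rewrite mulVf ?gt_eqF // scale1r.
(* The equality [rho = sigma] now says that [X] divided by [t] is zero. *)
rewrite /rho scalerDr scalerA tV scale1r => /(canRL (addrK _)).
rewrite subrr => /eqP; rewrite scaler_eq0 => /orP[|/eqP //].
by rewrite eq_complex /= eqxx andbT invr_eq0 gt_eqF.
Qed.

(** Averaging the expansion of [X] in matrix units with its adjoint gives real coefficients and
    Hermitian summands. This matters because the axioms of [norm_on_herm] speak only of Hermitian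
    matrices. *)
Lemma hermitian_sum_delta (R : realType) d (X : 'M[complex R]_d) :
  Defs.hermitian X ->
  X = \sum_i \sum_j
    (((complex.Re (X i j))%:C)%C *:
        (((2^-1 : R)%:C)%C *: (delta_mx i j + delta_mx j i))
     + ((complex.Im (X i j))%:C)%C *:
        (((2^-1 : R)%:C)%C *: ('i%C *: (delta_mx i j - delta_mx j i)))).
Proof.
move=> hX.
have XX : ((2^-1 : R)%:C)%C *: (X + X) = X.
  have -> : X + X = ((2 : R)%:C)%C *: X by rewrite rmorph_nat scaler_nat mulr2n.
  by rewrite scalerA -rmorphM /= mulVf ?pnatr_eq0 // scale1r.
have X2 : X = \sum_i \sum_j (X i j)^* *: delta_mx j i.
  by rewrite -[LHS]hX adjmxE [LHS]matrix_sum_delta exchange_big /=;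
    do 2![apply: eq_bigr => ? _]; rewrite !mxE.
rewrite -[LHS]XX {1}(matrix_sum_delta X) [X in _ + X]X2.
rewrite -big_split scaler_sumr; apply: eq_bigr => i _.
rewrite -big_split scaler_sumr; apply: eq_bigr => j _ /=.
rewrite !scalerA ![_ * (2^-1)%:C%C]mulrC -!scalerA -scalerDr; congr (_ *: _).
rewrite !scalerDr !scalerN !scalerA -!scaleNr addrACA -!scalerDl.
case: (X i j) => a b; congr (_ *: _ + _ *: _); apply/eqP; rewrite eq_complex /=;
  by rewrite !(mul0r, mulr0, mul1r, mulr1, subr0, sub0r, addr0, add0r, oppr0) !eqxx.
Qed.

(** * Continuity of complex matrix-valued functions *)

Lemma continuous_sumr (R : realType) (T : topologicalType) (I : Type)
    (r : seq I) (f : I -> T -> R) :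
  (forall i, continuous (f i)) -> continuous (fun x => \sum_(i <- r) f i x).
Proof.
move=> fc; elim: r => [|i r IH].
  under eq_fun do rewrite big_nil; exact: cst_continuous.
under eq_fun do rewrite big_cons; move=> x.
by apply: cvgD; [exact: fc | exact: IH].
Qed.

(** Continuity is tested on real and imaginary parts, so that the topology of [R] suffices. *)
Definition ccontinuous (R : realType) (T : topologicalType)
    (f : T -> complex R) : Prop :=
  continuous (fun x => complex.Re (f x)) /\
  continuous (fun x => complex.Im (f x)).

Lemma ccontinuous_cst (R : realType) (T : topologicalType) (c : complex R) :
  ccontinuous (fun _ : T => c).
Proof. by split; exact: cst_continuous. Qed.

Lemma ccontinuousD (R : realType) (T : topologicalType)
    (f g : T -> complex R) :
  ccontinuous f -> ccontinuous g -> ccontinuous (fun x => f x + g x).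
Proof.
move=> [f1 f2] [g1 g2]; split=> x.
  under eq_fun do rewrite raddfD /=.
  by apply: cvgD; [exact: f1 | exact: g1].
under eq_fun do rewrite raddfD /=.
by apply: cvgD; [exact: f2 | exact: g2].
Qed.

Lemma ccontinuousN (R : realType) (T : topologicalType) (f : T -> complex R) :
  ccontinuous f -> ccontinuous (fun x => - f x).
Proof.
move=> [f1 f2]; split=> x.
  under eq_fun do rewrite raddfN /=.
  by apply: cvgN; exact: f1.
under eq_fun do rewrite raddfN /=.
by apply: cvgN; exact: f2.
Qed.

Lemma ccontinuousM (R : realType) (T : topologicalType)
    (f g : T -> complex R) :
  ccontinuous f -> ccontinuous g -> ccontinuous (fun x => f x * g x).
Proof.
have ReM (x y : complex R) : complex.Re (x * y) =
  complex.Re x * complex.Re y - complex.Im x * complex.Im y.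
  by case: x y => a b [].
have ImM (x y : complex R) : complex.Im (x * y) =
  complex.Re x * complex.Im y + complex.Im x * complex.Re y.
  by case: x y => a b [].
move=> [f1 f2] [g1 g2]; split=> x.
  under eq_fun do rewrite ReM.
  by apply: cvgB; apply: cvgM;
    [exact: f1 | exact: g1 | exact: f2 | exact: g2].
under eq_fun do rewrite ImM.
by apply: cvgD; apply: cvgM;
  [exact: f1 | exact: g2 | exact: f2 | exact: g1].
Qed.

Lemma ccontinuous_conj (R : realType) (T : topologicalType)
    (f : T -> complex R) :
  ccontinuous f -> ccontinuous (fun x => (f x)^*).
Proof.
move=> [f1 f2]; split=> x.
  have -> : (fun y => complex.Re (f y)^*) = (fun y => complex.Re (f y)).
    by apply/funext => y; case: (f y).
  exact: f1.
have -> : (fun y => complex.Im (f y)^*) = (fun y => - complex.Im (f y)).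
  by apply/funext => y; case: (f y).
by apply: cvgN; exact: f2.
Qed.

Lemma ccontinuous_sum (R : realType) (T : topologicalType) (I : Type)
    (r : seq I) (f : I -> T -> complex R) :
  (forall i, ccontinuous (f i)) -> ccontinuous (fun x => \sum_(i <- r) f i x).
Proof.
move=> fc; elim: r => [|i r IH].
  under eq_fun do rewrite big_nil; exact: ccontinuous_cst.
by under eq_fun do rewrite big_cons; apply: ccontinuousD.
Qed.

Definition mxcontinuous (R : realType) (T : topologicalType) (p q : nat)
    (F : T -> 'M[complex R]_(p, q)) : Prop :=
  forall i j, ccontinuous (fun x => F x i j).

Lemma mxcontinuous_cst (R : realType) (T : topologicalType) p q
    (A : 'M[complex R]_(p, q)) : mxcontinuous (fun _ : T => A).
Proof. by move=> i j; exact: ccontinuous_cst. Qed.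

Lemma mxcontinuousB (R : realType) (T : topologicalType) p q
    (F G : T -> 'M[complex R]_(p, q)) :
  mxcontinuous F -> mxcontinuous G -> mxcontinuous (fun x => F x - G x).
Proof.
move=> Fc Gc i j; under eq_fun do rewrite !mxE.
by apply: ccontinuousD => //; exact: ccontinuousN.
Qed.

Lemma mxcontinuousM (R : realType) (T : topologicalType) p q r
    (F : T -> 'M[complex R]_(p, q)) (G : T -> 'M[complex R]_(q, r)) :
  mxcontinuous F -> mxcontinuous G -> mxcontinuous (fun x => F x *m G x).
Proof.
move=> Fc Gc i j; under eq_fun do rewrite mxE.
by apply: ccontinuous_sum => k; exact: ccontinuousM.
Qed.

Lemma mxcontinuous_adj (R : realType) (T : topologicalType) p q
    (F : T -> 'M[complex R]_(p, q)) :
  mxcontinuous F -> mxcontinuous (fun x => adjmx (F x)).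
Proof.
by move=> Fc i j; under eq_fun do rewrite adjmxE !mxE; exact: ccontinuous_conj.
Qed.

Lemma closed_continuous_eq (R : realType) (T : topologicalType) (f g : T -> R) :
  continuous f -> continuous g -> closed [set x | f x = g x].
Proof.
move=> fc gc.
have -> : [set x | f x = g x] = (fun x => f x - g x) @^-1` [set y | y = 0].
  apply/seteqP; split=> x /= /eqP; first by rewrite -subr_eq0 => /eqP.
  by rewrite subr_eq0 => /eqP.
apply: preimage_closed; last exact: closed_eq.
by move=> x _; apply: cvgB; [exact: fc | exact: gc].
Qed.

Lemma closed_ccontinuous_eq (R : realType) (T : topologicalType)
    (f g : T -> complex R) :
  ccontinuous f -> ccontinuous g -> closed [set x | f x = g x].
Proof.
move=> [f1 f2] [g1 g2].
have -> : [set x | f x = g x] =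
    [set x | complex.Re (f x) = complex.Re (g x)]
    `&` [set x | complex.Im (f x) = complex.Im (g x)].
  apply/funext => x /=; apply/propext; split=> [->//|[/eqP e1 /eqP e2]].
  by apply/eqP; rewrite eq_complex e1 e2.
by apply: closedI; exact: closed_continuous_eq.
Qed.

Lemma closed_ccontinuous_ge0 (R : realType) (T : topologicalType)
    (f : T -> complex R) : ccontinuous f -> closed [set x | 0 <= f x].
Proof.
move=> [f1 f2].
have -> : [set x | 0 <= f x] =
    [set x | complex.Im (f x) = 0] `&`
    (fun x => complex.Re (f x)) @^-1` [set y | 0 <= y].
  apply/funext => x /=; apply/propext; rewrite lecE.
  by split=> [/andP[/eqP]|[/= -> ->]]; rewrite ?eqxx.
apply: closedI.
  by apply: closed_continuous_eq => //; exact: cst_continuous.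
by apply: preimage_closed; [move=> x _; exact: f1 | exact: closed_ge].
Qed.

Lemma closed_mxcontinuous_eq (R : realType) (T : topologicalType) p q
    (F G : T -> 'M[complex R]_(p, q)) :
  mxcontinuous F -> mxcontinuous G -> closed [set x | F x = G x].
Proof.
move=> Fc Gc.
have -> : [set x | F x = G x] =
    \bigcap_(ij in setT) [set x | F x ij.1 ij.2 = G x ij.1 ij.2].
  apply/seteqP; split=> x /= FG; first by move=> ij _ /=; rewrite FG.
  by apply/matrixP => i j; exact: (FG (i, j)).
by apply: closed_bigI => ij _; exact: closed_ccontinuous_eq.
Qed.

(** * Real coordinates on complex matrices *)

Definition complex_mx (R : realType) (p q : nat)
    (x : 'rV[R]_(p * q + p * q)) : 'M[complex R]_(p, q) :=
  \matrix_(i, j) (vec_mx (lsubmx x) i j +i* vec_mx (rsubmx x) i j)%C.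

(** Real row vectors are the setting in which compactness and the extreme value theorem are applied
    below. *)
Definition real_rV (R : realType) (p q : nat) (A : 'M[complex R]_(p, q)) :
    'rV[R]_(p * q + p * q) :=
  row_mx (mxvec (map_mx (@complex.Re R) A)) (mxvec (map_mx (@complex.Im R) A)).

Lemma real_rVK (R : realType) p q : cancel (@real_rV R p q) (@complex_mx R p q).
Proof.
move=> A; apply/matrixP => i j.
by rewrite mxE /real_rV row_mxKl row_mxKr !mxvecK !mxE; case: (A i j).
Qed.

Lemma complex_mxK (R : realType) p q :
  cancel (@complex_mx R p q) (@real_rV R p q).
Proof.
move=> x; rewrite -[RHS]hsubmxK; congr (row_mx _ _); apply: (canLR vec_mxK);
  by apply/matrixP => i j; rewrite !mxE.
Qed.

Lemma complex_mx_continuous (R : realType) p q :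
  mxcontinuous (@complex_mx R p q).
Proof.
move=> i j; split=> x; under eq_fun do rewrite !mxE /=;
  exact: coord_continuous.
Qed.

(** * Norm comparison *)

(** The intermediate norm of the argument: it bounds the given norm on Hermitian matrices from
    above, and measurement data are bounded below in terms of it. *)
Definition entry_norm (R : realType) p q (A : 'M[complex R]_(p, q)) : R :=
  \sum_i \sum_j (`|complex.Re (A i j)| + `|complex.Im (A i j)|).

Lemma entry_norm_continuous (R : realType) (T : topologicalType) p q
    (F : T -> 'M[complex R]_(p, q)) :
  mxcontinuous F -> continuous (fun x => entry_norm (F x)).
Proof.
move=> Fc; apply: continuous_sumr => i; apply: continuous_sumr => j x.
by have [F1 F2] := Fc i j; apply: cvgD; apply: cvg_norm; [exact: F1 | exact: F2].
Qed.

Lemma entry_norm_ge0 (R : realType) p q (A : 'M[complex R]_(p, q)) :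
  0 <= entry_norm A.
Proof. by do 2!rewrite sumr_ge0 // => ? _; rewrite addr_ge0. Qed.

Lemma entry_normZ (R : realType) p q (a : R) (A : 'M[complex R]_(p, q)) :
  entry_norm ((a%:C)%C *: A) = `|a| * entry_norm A.
Proof.
rewrite /entry_norm mulr_sumr; apply: eq_bigr => i _; rewrite mulr_sumr.
apply: eq_bigr => j _; rewrite mxE mulrDr -!normrM.
by case: (A i j) => x y /=; rewrite !mul0r subr0 addr0.
Qed.

Lemma entry_norm_ge (R : realType) p q (A : 'M[complex R]_(p, q)) i j :
  `|complex.Re (A i j)| + `|complex.Im (A i j)| <= entry_norm A.
Proof.
rewrite /entry_norm (bigD1 i) //= (bigD1 j) //= -addrA lerDl addr_ge0 //.
  by rewrite sumr_ge0 // => k _; rewrite addr_ge0.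
by rewrite sumr_ge0 // => k _; rewrite sumr_ge0 // => k' _; rewrite addr_ge0.
Qed.

Lemma norm_on_mx0 (R : realType) l m (N : 'M[R]_(l, m) -> R) :
  norm_on_mx N -> N 0 = 0.
Proof. by move=> [_ _ NZ _]; rewrite -(scale0r 0) NZ normr0 mul0r. Qed.

Lemma norm_on_mxN (R : realType) l m (N : 'M[R]_(l, m) -> R) f :
  norm_on_mx N -> N (- f) = N f.
Proof. by move=> [_ _ NZ _]; rewrite -scaleN1r NZ normrN1 mul1r. Qed.

Lemma norm_on_mx_le_sum (R : realType) l m (N : 'M[R]_(l, m) -> R) f :
  norm_on_mx N -> N f <= \sum_i \sum_j `|f i j| * N (delta_mx i j).
Proof.
move=> hN; have [_ _ NZ ND] := hN.
have Nsum I (r : seq I) (g : I -> 'M[R]_(l, m)) :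
    N (\sum_(i <- r) g i) <= \sum_(i <- r) N (g i).
  elim: r => [|i r IH]; first by rewrite !big_nil norm_on_mx0.
  by rewrite !big_cons (le_trans (ND _ _)) // lerD2l.
rewrite [in leLHS](matrix_sum_delta f) (le_trans (Nsum _ _ _)) //.
apply: ler_sum => i _; rewrite (le_trans (Nsum _ _ _)) //.
by apply: ler_sum => j _; rewrite NZ.
Qed.

(** The norm [N] is arbitrary, so its continuity has to be derived: [N (F y)] is squeezed between
    [N (F x) - g y] and [N (F x) + g y], where [g] is a weighted sum of entry differences tending to
    0. *)
Lemma norm_on_mx_continuous (R : realType) (T : topologicalType) l m
    (N : 'M[R]_(l, m) -> R) (F : T -> 'M[R]_(l, m)) :
  norm_on_mx N -> (forall i j, continuous (fun x => F x i j)) ->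
  continuous (fun x => N (F x)).
Proof.
move=> hN Fc x; have [_ _ _ ND] := hN.
have Nd a b : N a - N b <= N (a - b).
  by rewrite lerBlDr -{1}(subrK b a) ND.
pose g y := \sum_i \sum_j `|F y i j - F x i j| * N (delta_mx i j).
have gc : continuous g.
  apply: continuous_sumr => i; apply: continuous_sumr => j y.
  apply: cvgM; last exact: cst_continuous.
  by apply: cvg_norm; apply: cvgB; [exact: Fc | exact: cst_continuous].
have gx : g x = 0.
  rewrite /g big1 // => i _; rewrite big1 // => j _.
  by rewrite subrr normr0 mul0r.
have g0 : g y @[y --> x] --> 0 by rewrite -gx; exact: gc.
have leg y : N (F x) - g y <= N (F y) <= N (F x) + g y.
  have -> : g y = \sum_i \sum_j `|(F y - F x) i j| * N (delta_mx i j).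
    by apply: eq_bigr => i _; apply: eq_bigr => j _; rewrite !mxE.
  have h := norm_on_mx_le_sum (F y - F x) hN.
  rewrite lerBlDr addrC -lerBlDr (le_trans (Nd _ _)) /=; last first.
    by rewrite -norm_on_mxN // opprB.
  by rewrite addrC -lerBlDr (le_trans (Nd _ _)).
apply: (@squeeze_cvgr _ _ _ _ (fun y => N (F x) - g y) (fun y => N (F x) + g y)).
- by apply: nearW.
- by rewrite -[X in _ --> X]subr0; apply: cvgB => //; exact: cvg_cst.
- by rewrite -[X in _ --> X]addr0; apply: cvgD => //; exact: cvg_cst.
Qed.

Lemma norm_on_herm_le (R : realType) d (N : 'M[complex R]_d -> R) :
  norm_on_herm N -> exists K : R, 0 < K /\
    forall X, Defs.hermitian X -> N X <= K * entry_norm X.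
Proof.
move=> [N_ge0 _ NZ ND].
pose e (i j : 'I_d) : 'M[complex R]_d := delta_mx i j.
pose A i j : 'M[complex R]_d := ((2^-1 : R)%:C)%C *: (e i j + e j i).
pose B i j : 'M[complex R]_d := ((2^-1 : R)%:C)%C *: ('i%C *: (e i j - e j i)).
have hD (X Y : 'M[complex R]_d) :
    Defs.hermitian X -> Defs.hermitian Y -> Defs.hermitian (X + Y).
  by move=> hX hY; rewrite /Defs.hermitian adjmxD hX hY.
have h0 : Defs.hermitian (0 : 'M[complex R]_d).
  by rewrite /Defs.hermitian adjmxE trmx0 map_mx0.
have he i j : adjmx (e i j) = e j i.
  by apply/matrixP => p q; rewrite adjmxE !mxE conjC_nat andbC.
have hA i j : Defs.hermitian (A i j).
  by apply: hermitianZ; rewrite /Defs.hermitian adjmxD !he addrC.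
have hB i j : Defs.hermitian (B i j).
  apply: hermitianZ; rewrite /Defs.hermitian adjmxZ adjmxB !he.
  rewrite -opprB scalerN -scaleNr.
  by congr (_ *: _); apply/eqP; rewrite eq_complex /= !oppr0 opprK !eqxx.
(* The added 1 keeps [K] positive even when the sum is empty. *)
pose K := 1 + \sum_i \sum_j (N (A i j) + N (B i j)).
have sum_ge0 : 0 <= \sum_i \sum_j (N (A i j) + N (B i j)).
  by do 2!rewrite sumr_ge0 // => ? _; rewrite addr_ge0 // N_ge0.
exists K; split; first by rewrite ltr_pwDl.
move=> X hX.
have XE : X = \sum_i \sum_j (((complex.Re (X i j))%:C)%C *: A i j
                           + ((complex.Im (X i j))%:C)%C *: B i j).
  exact: hermitian_sum_delta.
(* The induction carries hermiticity along, since the triangle inequality is available only between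
   Hermitian matrices. *)
have Nsum I (r : seq I) (g : I -> 'M[complex R]_d) :
    (forall i, Defs.hermitian (g i)) ->
    Defs.hermitian (\sum_(i <- r) g i) /\
    N (\sum_(i <- r) g i) <= \sum_(i <- r) N (g i).
  move=> hg; elim: r => [|i r [IH1 IH2]].
    by rewrite !big_nil; split => //; rewrite -(scale0r 0) (NZ 0) // normr0 mul0r.
  rewrite !big_cons; split; first exact: hD.
  by rewrite (le_trans (ND _ _ _ _)) // lerD2l.
have hAB i j : Defs.hermitian (((complex.Re (X i j))%:C)%C *: A i j
                           + ((complex.Im (X i j))%:C)%C *: B i j).
  by apply: hD; apply: hermitianZ.
rewrite {1}XE (le_trans (Nsum _ _ _ _).2) //.
  by move=> i; have [] := Nsum _ (index_enum 'I_d) _ (hAB i).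
rewrite /K mulrDl mul1r ler_wpDl ?entry_norm_ge0 //.
rewrite mulr_suml; apply: ler_sum => i _.
rewrite (le_trans (Nsum _ _ _ (hAB i)).2) // mulr_suml; apply: ler_sum => j _.
rewrite (le_trans (ND _ _ (hermitianZ _ (hA _ _)) (hermitianZ _ (hB _ _)))) //.
rewrite (NZ _ _ (hA i j)) (NZ _ _ (hB i j)).
have Xij := entry_norm_ge X i j.
rewrite mulrDl lerD // mulrC ler_wpM2l ?N_ge0 // (le_trans _ Xij) //.
  by rewrite lerDl.
by rewrite lerDr.
Qed.

(** * The lower bound on measurement data *)

(** A rank factorisation [sigma = a *m b] has [b *m a = 1] by the trace condition, so [sigma] is
    idempotent. Hence [sigma = sigma *m adjmx sigma] is [a *m adjmx a] scaled by the nonnegative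
    number [b *m adjmx b], whose square root is absorbed into [a]. *)
Lemma pure_state_outerP (R : realType) d (sigma : 'M[complex R]_d) :
  pure_state sigma ->
  exists2 u : 'cV[complex R]_d, adjmx u *m u = 1%:M & sigma = u *m adjmx u.
Proof.
move=> [[[hs _] trs] rk].
move: (col_base sigma) (row_base sigma) (mulmx_base sigma); rewrite rk => a b ab.
have ba : b *m a = 1%:M.
  by rewrite [LHS]mx11_scalar -trace_mx11 mxtrace_mulC ab trs.
have ss : sigma *m sigma = sigma.
  by rewrite -ab mulmxA -(mulmxA a) ba mulmx1.
have r_ge0 : 0 <= (b *m adjmx b) 0 0.
  by rewrite -{1}[b]adjmxK; exact: adj_mulmx_ge0.
set q := (b *m adjmx b) 0 0 in r_ge0; pose r := sqrtC q.
have bb : b *m adjmx b = q%:M by exact: mx11_scalar.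
have r_real : r^* = r by apply/CrealP; rewrite ger0_real // sqrtC_ge0.
have sE : sigma = (r *: a) *m adjmx (r *: a).
  rewrite adjmxZ r_real -scalemxAl -scalemxAr scalerA -expr2 sqrtCK.
  rewrite -{1}ss -{2}hs -ab adjmxM mulmxA -(mulmxA a b) bb.
  by rewrite mul_mx_scalar -scalemxAl.
exists (r *: a) => //.
by rewrite [LHS]mx11_scalar -trace_mx11 mxtrace_mulC -sE trs.
Qed.

Lemma compact_min_gt0 (R : realType) n (A : set 'rV[R]_n) (h : 'rV[R]_n -> R) :
  compact A -> continuous h -> (forall x, A x -> 0 < h x) ->
  exists2 c, 0 < c & forall x, A x -> c <= h x.
Proof.
move=> Ac hc h_gt0.
have [A0|A0] := pselect (A !=set0); last first.
  by exists 1 => // x Ax; case: A0; exists x.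
have [x /set_mem Ax xmin] := EVT_min_rV A0 Ac (continuous_subspaceT hc).
by exists (h x); [exact: h_gt0 | move=> y Ay; apply: xmin; exact: mem_set].
Qed.

Lemma real_rV_le (R : realType) p q (A : 'M[complex R]_(p, q)) (M : R) :
  (forall i j, `|complex.Re (A i j)| <= M /\ `|complex.Im (A i j)| <= M) ->
  forall k, `|real_rV A 0 k| <= M.
Proof.
move=> AM k; rewrite /real_rV mxE.
by case: split_ordP => k' _; case/mxvec_indexP: k' => i j; rewrite mxvecE mxE;
  have [] := AM i j.
Qed.

Lemma unit_vector_le1 (R : realType) d (u : 'cV[complex R]_d) i :
  adjmx u *m u = 1%:M ->
  `|complex.Re (u i 0)| <= 1 /\ `|complex.Im (u i 0)| <= 1.
Proof.
move=> /matrixP/(_ 0 0); rewrite !mxE eqxx /= => u1.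
have : `|u i 0| ^+ 2 <= 1.
  rewrite -[leRHS]/(1%:R) -u1 (bigD1 i) //= adjmxE !mxE normCKC lerDl.
  by rewrite sumr_ge0 // => j _; rewrite !mxE mulrC mul_conjC_ge0.
rewrite normCK; case: (u i 0) => a b.
rewrite lecE /= => /andP[_]; rewrite mulrN opprK -!expr2 => ab.
have le1 (t : R) : t ^+ 2 <= 1 -> `|t| <= 1.
  by move=> t2; rewrite -(@expr_le1 _ 2) // -normrX ger0_norm ?sqr_ge0.
by split; apply: le1; apply: le_trans ab; rewrite ?lerDl ?lerDr sqr_ge0.
Qed.

Lemma compact_rV_box (R : realType) n (A : set 'rV[R]_n) (M : R) :
  closed A -> (forall x, A x -> forall k, `|x 0 k| <= M) -> compact A.
Proof.
move=> Ac AM.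
apply: (subclosed_compact Ac (rV_compact (fun=> @segment_compact R (- M) M))).
by move=> x Ax i /=; rewrite in_itv /= -ler_norml AM.
Qed.

Lemma meas_map_lower_bound (R : realType) d l m
    (P : 'I_l -> 'I_m -> 'M[complex R]_d) (i0 : 'I_l)
    (Nf : 'M[R]_(l, m) -> R) :
  norm_on_mx Nf -> povm (P i0) -> determines_pure P ->
  exists2 c : R, 0 < c & forall (Z : 'M[complex R]_d) (u : 'cV[complex R]_d),
    Defs.hermitian Z -> adjmx u *m u = 1%:M ->
    (forall w : 'cV[complex R]_d, adjmx u *m w = 0 ->
       0 <= (adjmx w *m Z *m w) 0 0) ->
    c * entry_norm Z <= Nf (meas_map P Z).
Proof.
move=> hN hP hdet; have [N_ge0 N_eq0 NZ ND] := hN.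
(* A pair is encoded as one block matrix: the first [d] columns are [Z], the last one is [u]. *)
pose W := @complex_mx R d (d + 1).
pose Z x := lsubmx (W x); pose u x := rsubmx (W x).
pose Q x := 1%:M - u x *m adjmx (u x).
have Zc : mxcontinuous Z.
  move=> i j; under eq_fun do rewrite mxE; exact: complex_mx_continuous.
have uc : mxcontinuous u.
  move=> i j; under eq_fun do rewrite mxE; exact: complex_mx_continuous.
have Qc : mxcontinuous Q.
  apply: mxcontinuousB; first exact: mxcontinuous_cst.
  by apply: mxcontinuousM => //; exact: mxcontinuous_adj.
(* Inserting the projection [Q x] lets [w] range over all vectors, independently of [x], so each [w]
   contributes a closed condition. *)
pose A : set 'rV[R]_(d * (d + 1) + d * (d + 1)) :=
  [set x | adjmx (Z x) = Z x] `&` [set x | adjmx (u x) *m u x = 1%:M] `&`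
  [set x | entry_norm (Z x) = 1] `&`
  (\bigcap_(w in [set: 'cV[complex R]_d])
     [set x | 0 <= (adjmx w *m Q x *m Z x *m Q x *m w) 0 0]).
have Acl : closed A.
  apply: closedI; [apply: closedI; [apply: closedI|]|].
  - by apply: closed_mxcontinuous_eq => //; exact: mxcontinuous_adj.
  - apply: closed_mxcontinuous_eq; last exact: mxcontinuous_cst.
    by apply: mxcontinuousM => //; exact: mxcontinuous_adj.
  - apply: closed_continuous_eq; last exact: cst_continuous.
    exact: entry_norm_continuous.
  - apply: closed_bigI => w _; apply: closed_ccontinuous_ge0.
    have wc := mxcontinuous_cst _ w.
    have wac := mxcontinuous_cst _ (adjmx w).
    have QZQc := mxcontinuousM (mxcontinuousM (mxcontinuousM (wac _) Qc) Zc) Qc.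
    exact: (mxcontinuousM QZQc (wc _)).
(* Boundedness: the entries of [Z] are controlled by its entry norm 1, those of [u] by its unit
   length. *)
have Acomp : compact A.
  apply: (compact_rV_box (M := 1) Acl) => x [[[_ ux] Zx] _].
  rewrite -[x]complex_mxK; apply: real_rV_le => i j.
  rewrite -/(W x) -[W x]hsubmxK mxE; case: split_ordP => k _.
    have := entry_norm_ge (Z x) i k; rewrite Zx => Zik.
    by split; apply: le_trans Zik; rewrite ?lerDl ?lerDr.
  by rewrite ord1; exact: unit_vector_le1.
pose h x := Nf (meas_map P (Z x)).
have hc : continuous h.
  apply: norm_on_mx_continuous => // i j.
  under eq_fun do rewrite mxE.
  have : ccontinuous (fun x => \tr (Z x *m P i j)).
    apply: ccontinuous_sum => k.
    exact: (mxcontinuousM Zc (mxcontinuous_cst _ (P i j))).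
  by case.
have h_gt0 x : A x -> 0 < h x.
  move=> [[[hZ ux] Zx] QZQ]; rewrite lt_neqAle N_ge0 andbT eq_sym.
  apply/eqP => /N_eq0 MZ0.
  have Z0 : Z x = 0.
    apply: (@meas_map_inj_one_negative _ _ _ _ P i0 _ (adjmx (u x))) => // w uw.
    have := QZQ w I.
    (* On the hyperplane orthogonal to [u x] the projection is the identity, so membership in [A]
       gives nonnegativity of the form of [Z x] there. *)
    have Qw : Q x *m w = w by rewrite mulmxBl mul1mx -mulmxA uw mulmx0 subr0.
    have wQ : adjmx w *m Q x = adjmx w.
      by rewrite -[in RHS]Qw adjmxM adjmxB adjmxM adjmxK adjmx1.
    by rewrite /= wQ -mulmxA Qw.
  move/eqP: Zx; rewrite Z0 /entry_norm big1 ?(eq_sym 0) ?oner_eq0 // => i _.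
  by rewrite big1 // => j _; rewrite mxE normr0 addr0.
have [c c_gt0 cmin] := compact_min_gt0 Acomp hc h_gt0.
exists c => // Y v hY vv Yv.
have [->|Y_neq0] := eqVneq (entry_norm Y) 0; first by rewrite mulr0.
have E_gt0 : 0 < entry_norm Y by rewrite lt_neqAle eq_sym Y_neq0 entry_norm_ge0.
(* The normalised pair lies in [A], and homogeneity of [Nf] turns the minimum into the claimed
   bound. *)
pose Y' := ((entry_norm Y)^-1%:C)%C *: Y.
have Wx : W (real_rV (row_mx Y' v)) = row_mx Y' v by exact: real_rVK.
have Zx : Z (real_rV (row_mx Y' v)) = Y' by rewrite /Z Wx row_mxKl.
have ux : u (real_rV (row_mx Y' v)) = v by rewrite /u Wx row_mxKr.
have := cmin (real_rV (row_mx Y' v)).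
rewrite /h Zx meas_mapZ NZ ger0_norm ?invr_ge0 ?entry_norm_ge0 //.
rewrite mulrC ler_pdivlMr //; apply; split; [split; [split|]|].
- by rewrite /= Zx; exact: hermitianZ.
- by rewrite /= ux.
- by rewrite /= Zx entry_normZ ger0_norm ?invr_ge0 ?entry_norm_ge0 // mulVf.
- move=> w _; rewrite /= /Q ux Zx.
  (* The projected vector is orthogonal to [v] because [v] has unit length. *)
  have := Yv ((1%:M - v *m adjmx v) *m w).
  rewrite mulmxA mulmxBr mulmx1 mulmxA vv mul1mx subrr mul0mx => /(_ erefl).
  rewrite adjmxM adjmxB adjmxM adjmxK adjmx1 !mulmxA => YQ.
  rewrite /Y' -scalemxAr -!scalemxAl mxE mulr_ge0 //.
  by rewrite ler0c invr_ge0 entry_norm_ge0.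
Qed.

(** * From the lower bound to the recovery estimate *)

Theorem theorem3 (R : realType) (d l m : nat)
  (hd : (1 <= d)%N) (hl : (1 <= l)%N) (hm : (1 <= m)%N)
  (NH : 'M[complex R]_d -> R) (Nf : 'M[R]_(l, m) -> R)
  (hNH : norm_on_herm NH) (hNf : norm_on_mx Nf)
  (P : 'I_l -> 'I_m -> 'M[complex R]_d)
  (hP : forall i, povm (P i))
  (hdet : determines_pure P) :
  exists CQ : R, 0 < CQ /\
    forall (eps : R) (sigma : 'M[complex R]_d) (f : 'M[R]_(l, m)),
      0 < eps -> pure_state sigma -> Nf f <= eps ->
      forall Y : 'M[complex R]_d,
        sdp_minimizer P Nf eps (meas_map P sigma + f) Y ->
        NH (Y - sigma) <= CQ * eps.
Proof.
have [c c_gt0 cP] := meas_map_lower_bound hNf (hP (Ordinal hl)) hdet.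
have [K [K_gt0 KP]] := norm_on_herm_le hNH.
(* The data of [Y - sigma] have norm at most [2 * eps]; dividing by [c] bounds its entry norm, and
   [K] passes to [NH]. *)
exists (K * (2 / c)); split; first by rewrite !(mulr_gt0, invr_gt0).
move=> eps sigma f eps_gt0 ps fe Y [[[hY Y_ge0] Yfeas] _].
have [u uu sE] := pure_state_outerP ps.
have [[[hs _] _] _] := ps.
have hX : Defs.hermitian (Y - sigma) by rewrite /Defs.hermitian adjmxB hY hs.
apply: le_trans (KP _ hX) _; rewrite -mulrA (ler_wpM2l (ltW K_gt0)) //.
rewrite mulrAC ler_pdivlMr // mulrC.
apply: le_trans (cP _ u hX uu _) _.
  (* The form of [sigma] vanishes on vectors orthogonal to [u], leaving that of [Y]. *)
  move=> w uw; rewrite mulmxBr mulmxBl sE -!mulmxA uw !mulmx0 subr0 mulmxA.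
  exact: Y_ge0.
have [_ _ _ ND] := hNf.
(* The feasibility residual plus the noise, each of norm at most [eps]. *)
have -> : meas_map P (Y - sigma) = (meas_map P Y - (meas_map P sigma + f)) + f.
  by rewrite meas_mapB opprD addrA subrK.
by rewrite (le_trans (ND _ _)) // mulr2n mulrDl mul1r lerD.
Qed.
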